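(* Let $r\ge1$, let $m_1,\ldots,m_r$ be positive integers, $m=m_1+\cdots+m_r$, let $f_1,\ldots,f_r$ be real numbers none of which is a nonpositive integer, and let $$F_m(t)=\frac{(f_1+t)_{m_1}(f_2+t)_{m_2}\cdots(f_r+t)_{m_r}}{(f_1)_{m_1}(f_2)_{m_2}\cdots(f_r)_{m_r}} .$$ Suppose, without loss of generality, that $m_1=\max(m_1,\ldots,m_r)$ and put $\omega=m-m_1$. Then, assuming $a>0$ and $(f_1-a-\omega)_\omega\neq0$, we have $$\hat{w}(a;F_m\,|\,x)=\sum_{n=0}^{m}\frac{(-m)_n(f_1-a-\omega)_n}{(f_1)_n\,n!}\hat{Q}_\omega(n)x^n={}_{\omega+2}F_{\omega+1}\!\left(\begin{array}{c}-m,\,f_1-a-\omega,\,\eta_1+1,\ldots,\eta_\omega+1\\ f_1,\,\eta_1,\ldots,\eta_\omega\end{array}\Big|\,x\right),$$ where $\hat{Q}_\omega$ is the polynomial of degree $\omega$ given by $$\hat{Q}_\omega=\hat{T}_\omega(a,f_1+m_1;f_1)H,\qquad H(t)=\frac{(f_2+t)_{m_2}\cdots(f_r+t)_{m_r}}{(f_2)_{m_2}\cdots(f_r)_{m_r}},$$ $\hat{T}_\omega$ is the second Miller–Paris operator, and $\eta_1,\ldots,\eta_\omega$ are the roots of the polynomial $t\mapsto\hat{Q}_\omega(-t)$. If $a<0$, the formula still holds under the additional assumption $(1+a+m_1)_\omega\ne0$.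
   Context: $(b)_n=b(b+1)\cdots(b+n-1)$, $(b)_0=1$, is the Pochhammer symbol, and ${}_{p+1}F_{p}\!\left(\begin{array}{c}a_0,\ldots,a_p\\ b_1,\ldots,b_p\end{array}\Big|\,x\right)=\sum_{n\ge0}\frac{(a_0)_n\cdots(a_p)_n}{(b_1)_n\cdots(b_p)_n\,n!}x^n$ is the generalized hypergeometric function. The polynomial $\hat{w}(a;F_m\,|\,x)$ of degree at most $m$ is defined by $$\sum_{n=0}^{\infty}F_m(n)\frac{(a)_n}{n!}x^n=\frac{\hat{w}(a;F_m\,|\,x)}{(1-x)^{m+a}} .$$ Miller–Paris operators: for an integer $\omega\ge0$ and parameters with $(\rho-\epsilon-\omega)_\omega\ne0$, the first Miller–Paris operator $T_\omega(\epsilon;\rho)$ acts on polynomials $H$ by $$[T_\omega(\epsilon;\rho)H](t)=\frac{1}{(\rho-\epsilon-\omega)_\omega}\sum_{k=0}^{\omega}\frac{(-1)^k(\epsilon)_k(-t)_k(\rho-\epsilon-\omega+t)_{\omega-k}}{k!}\sum_{j=0}^{k}\frac{(-k)_j}{j!}H(j).$$ If moreover $(\rho-\delta-\omega)_\omega\ne0$, the second Miller–Paris operator is $\hat{T}_\omega(\delta,\epsilon;\rho)=T_\omega(\delta;\rho)\,T_\omega(\epsilon;\rho)$ (composition). It is the map $H\mapsto\hat{Q}$, for $H$ of degree $\omega$ with $H(0)=1$, in the generalized Euler transformation $$\sum_{n\ge0}\frac{(\delta)_n(\epsilon)_n}{(\rho)_n n!}H(n)x^n=(1-x)^{\rho-\delta-\epsilon-\omega}\sum_{n\ge0}\frac{(\rho-\delta-\omega)_n(\rho-\epsilon-\omega)_n}{(\rho)_n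 n!}\hat{Q}(n)x^n ,$$ valid when $(\rho-\epsilon-\omega)_\omega$, $(\rho-\delta-\omega)_\omega$ and $(1+\delta+\epsilon-\rho)_\omega$ are all nonzero.
   Formalization: ''Degree ω'' is proved as degree at most ω, since the degree can drop (r=2, m_1=m_2=1, a=1, f_1=5, f_2=2 gives Q̂=1); the second equality is stated when Q̂(-t) has ω roots with multiplicity and no (η_i)_m vanishes, so that the hypergeometric symbol is defined. *)

(* Defs.v *)
From HB Require Import structures.
From mathcomp Require Export all_boot all_order all_algebra.
From mathcomp Require Export complex.
From mathcomp Require Export all_classical all_reals all_analysis.
Set Implicit Arguments.
Unset Strict Implicit.
Unset Printing Implicit Defensive.
Import Order.TTheory GRing.Theory Num.Theory.
Import numFieldNormedType.Exports.
Local Open Scope classical_set_scope.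
Local Open Scope ring_scope.

(* Over a polynomial ring this also gives the polynomials t |-> (c + t)_n,
   as [poch (c%:P + 'X) n]. *)
Definition poch (A : pzRingType) (b : A) (n : nat) : A :=
  \prod_(i < n) (b + i%:R).

(* Sum of the series at x; terms whose denominator vanishes are 0 because
   0^-1 = 0, and the value is meaningful only when no denominator vanishes
   before the numerator does. *)
Definition hypergeom (K : numFieldType) (aa bb : seq K) (x : K) : K :=
  limn (series (fun n : nat =>
    (\prod_(b <- aa) poch b n) / (\prod_(b <- bb) poch b n * (n`!)%:R) * x ^+ n
      : K^o)).

(* t |-> \prod_(i | P i) (f_i + t)_{m_i} / (f_i)_{m_i} *)
Definition poch_ratio (R : fieldType) (I : finType) (P : pred I)
    (f : I -> R) (m : I -> nat) : {poly R} :=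
  (\prod_(i | P i) poch (f i) (m i))^-1 *:
    \prod_(i | P i) poch ((f i)%:P + 'X) (m i).

Definition is_what (R : realType) (m : nat) (a : R) (F w : {poly R}) : Prop :=
  (size w <= m.+1)%N /\
  forall x : R, `|x| < 1 ->
    series (fun n : nat => F.[n%:R] * (poch a n / (n`!)%:R) * x ^+ n) @ \oo -->
      w.[x] / (1 - x) `^ (m%:R + a).

(* The polynomial with this property; the default 0 is irrelevant, since a
   polynomial F of degree at most m admits exactly one such w. *)
Definition what (R : realType) (m : nat) (a : R) (F : {poly R}) : {poly R} :=
  xget 0 [set w | is_what m a F w].

(* Meaningful when (rho - eps - omega)_omega != 0. *)
Definition MP1 (R : fieldType) (omega : nat) (eps rho : R) (H : {poly R}) :
    {poly R} :=
  (poch (rho - eps - omega%:R) omega)^-1 *: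
  \sum_(k < omega.+1)
    ((-1) ^+ k * poch eps k / (k`!)%:R *
      \sum_(j < k.+1) poch (- k%:R) j / (j`!)%:R * H.[j%:R]) *:
    (poch (- 'X) k * poch ((rho - eps - omega%:R)%:P + 'X) (omega - k)).

Definition MP2 (R : fieldType) (omega : nat) (delta eps rho : R)
    (H : {poly R}) : {poly R} :=
  MP1 omega delta rho (MP1 omega eps rho H).

(* s lists all the roots of p != 0, with multiplicity *)
Definition is_root_list (K : fieldType) (p : {poly K}) (s : seq K) : Prop :=
  p = lead_coef p *: \prod_(z <- s) ('X - z%:P).

(* Main.v *)
Require Import Defs.
From mathcomp Require Import ring lra zify.
Set Implicit Arguments.
Unset Strict Implicit.
Unset Printing Implicit Defensive.
Import Order.TTheory GRing.Theory Num.Theory.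
Import numFieldNormedType.Exports.
Local Open Scope classical_set_scope.
Local Open Scope ring_scope.

(** Every polynomial is expanded in the Newton basis t |-> (-t)_k, on which
    all the maps involved act simply.

    On the analytic side, the binomial series gives
      sum_n (-n)_k (a)_n / n! x^n = (-1)^k (a)_k x^k (1 - x)^(-a-k),
    so if F(t) = sum_(k <= m) g_k (-t)_k, then the polynomial attached to F is
      w(x) = sum_(k <= m) g_k (-1)^k (a)_k x^k (1 - x)^(m-k)
    ([is_what_newton]); it is unique because a polynomial is determined by its
    values on |x| < 1 ([is_what_unique]).

    On the algebraic side, write s = rho - eps - omega.  The first Miller-Paris
    operator multiplies the Newton basis vector (-t)_k by
    (-1)^k (eps)_k (s + t)_(omega-k) / (s)_omega.  At t = n this turns the
    weight (s)_n into (rho - eps)_(n-k), so that (s)_n [T H](n) has no more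
    denominator and no more dependence on omega ([poch_MP1_nat]).  Two finite
    hypergeometric sums then do the work.
    - For F(t) = (f1 + t)_m1 / (f1)_m1 H(t) and Q1 = T(f1 + m1; f1) H, the
      Chu-Vandermonde sum shows that the Newton coefficients of F are
      g_n = (-m)_n / ((f1)_n n!) Q1(n) ([MP1_newton]).
    - For Q = T(a; f1) Q1, a terminating form of the Pfaff transformation
      rewrites sum_n g_n (-1)^n (a)_n x^n (1 - x)^(m-n) as
      sum_n (-m)_n (f1 - a - omega)_n / ((f1)_n n!) Q(n) x^n ([MP1_pfaff]).

    The hypergeometric form follows from Q(0) = 1: if eta lists the roots of
    Q(-t), then (eta_1 + 1)_n ... (eta_omega + 1)_n
    = (eta_1)_n ... (eta_omega)_n Q(n) ([prod_poch_roots]). *)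

(** * Pochhammer symbols *)

Lemma poch0 (A : pzRingType) (b : A) : poch b 0 = 1.
Proof. by rewrite /poch big_ord0. Qed.

Lemma pochSr (A : pzRingType) (b : A) n : poch b n.+1 = poch b n * (b + n%:R).
Proof. by rewrite /poch big_ord_recr. Qed.

Lemma pochS (A : pzRingType) (b : A) n : poch b n.+1 = b * poch (b + 1) n.
Proof.
rewrite /poch big_ord_recl addr0; congr (_ * _).
by apply: eq_bigr => i _; rewrite -addrA -mulrS.
Qed.

Lemma pochD (A : pzRingType) (b : A) k n :
  poch b (k + n) = poch b k * poch (b + k%:R) n.
Proof.
elim: n => [|n IH]; first by rewrite addn0 poch0 mulr1.
by rewrite addnS !pochSr IH natrD addrA mulrA.
Qed.

Lemma rmorph_poch (A B : pzRingType) (g : {rmorphism A -> B}) (b : A) n :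
  g (poch b n) = poch (g b) n.
Proof.
by rewrite /poch rmorph_prod; apply: eq_bigr => i _; rewrite rmorphD rmorph_nat.
Qed.

Lemma pochN_nat (A : pzRingType) (n k : nat) :
  poch (- n%:R : A) k = (-1) ^+ k * (n ^_ k)%:R.
Proof.
elim: k => [|k IH]; first by rewrite poch0 ffactn0 mulr1.
rewrite pochSr IH ffactnSr exprSr natrM -!mulrA; congr (_ * _).
rewrite mulrA mulN1r; have [kn|nk] := leqP k n.
  by rewrite natrB // mulNr -mulrN opprB addrC.
by rewrite ffact_small // oppr0 !mul0r.
Qed.

Lemma pochN_nat_small (A : pzRingType) (n k : nat) :
  (n < k)%N -> poch (- n%:R : A) k = 0.
Proof. by move=> nk; rewrite pochN_nat ffact_small // mulr0. Qed.

Lemma pochN_nat_fact (K : numFieldType) (n k : nat) :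
  poch (- n%:R : K) k / (k`!)%:R = (-1) ^+ k * ('C(n, k))%:R.
Proof.
rewrite pochN_nat -bin_ffact natrM mulrA mulfK //.
Qed.

Lemma poch_neq0_trunc (A : pzRingType) (b : A) (k n : nat) :
  (k <= n)%N -> poch b n != 0 -> poch b k != 0.
Proof.
by move=> /subnKC <-; rewrite pochD; apply: contra_neq => ->; rewrite mul0r.
Qed.

(** Pascal's rule, summed against an arbitrary sequence. *)
Lemma sum_binS (A : pzRingType) (n : nat) (g : nat -> A) :
  \sum_(i < n.+2) 'C(n.+1, i)%:R * g i =
  \sum_(i < n.+1) 'C(n, i)%:R * (g i + g i.+1).
Proof.
rewrite big_ord_recl bin0.
under eq_bigr do rewrite /= binS natrD mulrDl.
rewrite big_split /= addrA.
under [RHS]eq_bigr do rewrite mulrDr.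
rewrite big_split /=; congr (_ + _).
rewrite big_ord_recr /= bin_small // mul0r addr0.
by rewrite [RHS]big_ord_recl bin0.
Qed.

(** * Two terminating hypergeometric sums *)

(** The Chu-Vandermonde sum 2F1(-n, b; c; 1), cleared of denominators.  Pascal's
    rule reduces it to the same sum at (n - 1, b, c + 1). *)
Lemma chu_vandermonde (A : comPzRingType) (b c : A) n :
  \sum_(i < n.+1) 'C(n, i)%:R * ((-1) ^+ i * poch b i * poch (c + i%:R) (n - i)) =
  poch (c - b) n.
Proof.
elim: n c => [|n IH] c.
  by rewrite big_ord1 /= !poch0 expr0 !mulr1.
rewrite (sum_binS n (fun i => (-1) ^+ i * poch b i * poch (c + i%:R) (n.+1 - i))).
rewrite pochS -[c - b + 1]addrAC -IH mulr_sumr.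
apply: eq_bigr => i _; have le_in : (i <= n)%N by rewrite -ltnS.
rewrite subSn // pochS subSS pochSr exprS.
rewrite -[i.+1]add1n natrD addrA [c + i%:R + 1]addrAC; ring.
Qed.

(** The terminating Pfaff transformation
      (1 - x)^n 2F1(-n, a; c; x / (x - 1)) = 2F1(-n, c - a; c; x),
    cleared of denominators.  Both sides satisfy
    S(n + 1, c) = (c + n) S(n, c) + (a - c) x S(n, c + 1). *)
Lemma pfaff_sum (A : comPzRingType) (a c x : A) n :
  \sum_(i < n.+1) 'C(n, i)%:R *
     (poch a i * poch (c + i%:R) (n - i) * x ^+ i * (1 - x) ^+ (n - i)) =
  \sum_(i < n.+1) 'C(n, i)%:R *
     ((-1) ^+ i * poch (c - a) i * poch (c + i%:R) (n - i) * x ^+ i).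
Proof.
elim: n c => [|n IH] c; first by rewrite !big_ord1 /= !poch0.
rewrite (sum_binS n (fun i => poch a i * poch (c + i%:R) (n.+1 - i) * x ^+ i *
   (1 - x) ^+ (n.+1 - i))).
rewrite (sum_binS n (fun i => (-1) ^+ i * poch (c - a) i *
   poch (c + i%:R) (n.+1 - i) * x ^+ i)).
(* The factor c + n of the recurrence comes from computing (c + i)_(n-i+1)
   from either end. *)
have shift i : (i <= n)%N ->
    (c + i%:R) * poch (c + 1 + i%:R) (n - i) = poch (c + i%:R) (n - i) * (c + n%:R).
  move=> le_in; rewrite addrAC -pochS pochSr.
  by rewrite -addrA -natrD subnKC.
transitivity ((c + n%:R) * \sum_(i < n.+1) 'C(n, i)%:R *
     (poch a i * poch (c + i%:R) (n - i) * x ^+ i * (1 - x) ^+ (n - i))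
   + (a - c) * x * \sum_(i < n.+1) 'C(n, i)%:R *
     (poch a i * poch (c + 1 + i%:R) (n - i) * x ^+ i * (1 - x) ^+ (n - i))).
  rewrite !mulr_sumr -big_split; apply: eq_bigr => i _ /=.
  have le_in : (i <= n)%N by rewrite -ltnS.
  rewrite subSn // subSS pochS pochSr.
  rewrite -[i.+1]add1n natrD addrA [c + i%:R + 1]addrAC !exprS.
  have := shift _ le_in; set u := poch _ _; set v := poch _ _ => e.
  transitivity ('C(n, i)%:R * poch a i * x ^+ i * (1 - x) ^+ (n - i) *
     ((c + i%:R) * u + (a - c) * x * u)); first by ring.
  by rewrite e; ring.
rewrite !IH !mulr_sumr -big_split; apply: eq_bigr => i _ /=.
have le_in : (i <= n)%N by rewrite -ltnS.
rewrite subSn // subSS pochS -[i.+1]add1n natrD addrA [c + i%:R + 1]addrAC.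
rewrite shift // [poch (c - a) (1 + i)]pochS [c - a + 1]addrAC !exprS; ring.
Qed.

(** * Newton expansion *)

Lemma sum_sign_bin (A : comPzRingType) n :
  \sum_(i < n.+1) 'C(n, i)%:R * (-1) ^+ i = (n == 0%N)%:R :> A.
Proof.
have := exprDn (1 : A) (-1) n; rewrite subrr expr0n => ->.
by apply: eq_bigr => i _; rewrite expr1n mul1r mulr_natl.
Qed.

Lemma fact_neq0 (K : numFieldType) n : (n`!)%:R != 0 :> K.
Proof. by rewrite pnatr_eq0 -lt0n fact_gt0. Qed.

(** Reindexing of sums whose first, or last, terms vanish. *)
Lemma sum_ord_drop (V : nmodType) (N k : nat) (G : nat -> V) :
  (k <= N)%N -> (forall n, (n < k)%N -> G n = 0) ->
  \sum_(n < N.+1) G n = \sum_(i < (N - k).+1) G (k + i)%N.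
Proof.
move=> kN G0; rewrite -(big_mkord xpredT G) -{1}(subnKC kN) -addnS big_mkord.
rewrite big_split_ord /= big1 ?add0r //.
by move=> i _; rewrite G0.
Qed.

Lemma sum_ord_trunc (V : nmodType) (M N : nat) (G : nat -> V) :
  (M <= N)%N -> (forall n, (M < n)%N -> G n = 0) ->
  \sum_(n < N.+1) G n = \sum_(i < M.+1) G i.
Proof.
move=> MN G0; rewrite -(big_mkord xpredT G) -(subnKC MN) -addSn big_mkord.
rewrite big_split_ord /= [X in _ + X]big1 ?addr0 //.
by move=> i _; rewrite G0 // addSn ltnS leq_addr.
Qed.

Lemma size_poch (A : nzRingType) (p : {poly A}) n :
  (size p <= 2)%N -> (size (poch p n) <= n.+1)%N.
Proof.
move=> sp; elim: n => [|n IH]; first by rewrite poch0 size_poly1.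
rewrite pochSr (leq_trans (size_polyMleq _ _)) //.
have s2 : (size (p + n%:R)%R <= 2)%N.
  rewrite (leq_trans (size_polyD _ _)) // geq_max sp /= -polyC_natr.
  by rewrite (leq_trans (size_polyC_leq1 _)).
by rewrite -subn1 leq_subLR (leq_trans (leq_add IH s2)) // addnC.
Qed.

Lemma horner_poch (A : comNzRingType) (p : {poly A}) n (t : A) :
  (poch p n).[t] = poch p.[t] n.
Proof. exact: (rmorph_poch (horner_eval t)). Qed.

Lemma size_pochNX (A : nzRingType) n : (size (poch (- 'X : {poly A})%R n) <= n.+1)%N.
Proof. by apply: size_poch; rewrite size_polyN size_polyX. Qed.

Lemma size_pochDX (A : nzRingType) (c : A) n :
  (size (poch (c%:P + 'X)%R n) <= n.+1)%N.
Proof. by apply: size_poch; rewrite addrC size_XaddC. Qed.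

(** Polynomials of degree at most d are determined by their values at
    0, ..., d. *)
Lemma poly_nat_inj (K : numFieldType) (p q : {poly K}) (d : nat) :
  (size p <= d.+1)%N -> (size q <= d.+1)%N ->
  (forall n, (n <= d)%N -> p.[n%:R] = q.[n%:R]) -> p = q.
Proof.
move=> sp sq e; apply/eqP; rewrite -subr_eq0; apply/negPn/negP => nz.
pose rs : seq K := [seq i%:R | i <- iota 0 d.+1].
have rs_root : all (root (p - q)) rs.
  rewrite all_map; apply/allP => i; rewrite mem_iota /= add0n ltnS => id.
  by rewrite /root !hornerE e // subrr.
have rs_uniq : uniq rs.
  rewrite map_inj_uniq ?iota_uniq // => i j /eqP.
  by rewrite eqr_nat => /eqP.
have := max_poly_roots nz rs_root rs_uniq.
rewrite size_map size_iota ltnNge (leq_trans (size_polyD _ _)) //.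
by rewrite size_polyN geq_max sp.
Qed.

(** The coefficient of H on (-X)_k in the basis ((-X)_k): up to the sign that
    (-X)_k carries, the k-th forward difference of H at 0 divided by k!. *)
Definition newton_coef (K : fieldType) (H : {poly K}) (k : nat) : K :=
  (k`!)%:R^-1 * \sum_(j < k.+1) poch (- k%:R) j / (j`!)%:R * H.[j%:R].

(** Since (-n)_k / k! = (-1)^k 'C(n, k), the binomial transform is an
    involution. *)
Lemma binomial_inversion (K : numFieldType) (h : nat -> K) n :
  \sum_(k < n.+1) poch (- n%:R) k / (k`!)%:R *
    \sum_(j < k.+1) poch (- k%:R) j / (j`!)%:R * h j = h n.
Proof.
transitivity (\sum_(k < n.+1) \sum_(j < n.+1)
    (-1) ^+ (k + j) * ('C(n, k) * 'C(k, j))%:R * h j).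
  apply: eq_bigr => k _.
  rewrite -(@sum_ord_trunc _ k n (fun j => poch (- k%:R) j / (j`!)%:R * h j));
    first last.
  - by move=> j kj; rewrite pochN_nat_small // !mul0r.
  - by rewrite -ltnS.
  rewrite mulr_sumr; apply: eq_bigr => j _.
  by rewrite !pochN_nat_fact exprD natrM; ring.
(* Only the diagonal term j = n survives. *)
rewrite exchange_big big_ord_recr /= big1 ?add0r => [|j _].
  rewrite big_ord_recr /= big1 ?add0r => [|k _].
    by rewrite !binn -signr_odd oddD addbb mul1r mul1r.
  by rewrite [X in (_ * X)%N]bin_small // muln0 mulr0 mul0r.
rewrite (@sum_ord_drop _ n j
  (fun k => (-1) ^+ (k + j) * ('C(n, k) * 'C(k, j))%:R * h j));
  first last.
- by move=> k kj; rewrite [X in (_ * X)%N]bin_small // muln0 mulr0 mul0r.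
- exact: ltnW.
transitivity ('C(n, j)%:R * h j * \sum_(i < (n - j).+1) 'C(n - j, i)%:R * (-1) ^+ i).
  rewrite mulr_sumr; apply: eq_bigr => i _.
  have ji : (j + i <= n)%N by rewrite -leq_subRL ?[(j <= n)%N]ltnW // -ltnS.
  have -> : ('C(n, j + i) * 'C(j + i, j) = 'C(n, j) * 'C(n - j, i))%N.
    apply/eqP; rewrite -(eqn_pmul2r (fact_gt0 j)) -(eqn_pmul2r (fact_gt0 i)).
    rewrite -(eqn_pmul2r (fact_gt0 (n - (j + i)))); apply/eqP.
    have e1 := bin_fact (leq_addr i j); rewrite addKn in e1.
    have e2 := bin_fact ji.
    have e3 := bin_fact (ltnW (ltn_ord j)).
    have /bin_fact e4 : (i <= n - j)%N by rewrite -ltnS.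
    rewrite -subnDA in e4.
    by lia.
  have -> : (-1) ^+ (j + i + j) = (-1) ^+ i :> K.
    by rewrite addnAC exprD -signr_odd addnn odd_double mul1r.
  by rewrite natrM; ring.
rewrite sum_sign_bin subn_eq0 leqNgt ltn_ord /=; ring.
Qed.

Lemma newton_expansion (K : numFieldType) (H : {poly K}) (d : nat) :
  (size H <= d.+1)%N ->
  H = \sum_(k < d.+1) newton_coef H k *: poch (- 'X) k.
Proof.
move=> sH; apply: (poly_nat_inj sH).
  rewrite (leq_trans (size_sum _ _ _)) //; apply/bigmax_leqP => k _.
  rewrite (leq_trans (size_scale_leq _ _)) // (leq_trans (size_pochNX _ _)) //.
move=> n nd; rewrite horner_sum -[LHS](binomial_inversion (fun j => H.[j%:R])).
rewrite -(@sum_ord_trunc _ n d (fun k => poch (- n%:R) k / (k`!)%:R *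
  \sum_(j < k.+1) poch (- k%:R) j / (j`!)%:R * H.[j%:R])) //; last first.
  by move=> k nk; rewrite pochN_nat_small // !mul0r.
apply: eq_bigr => k _; rewrite hornerZ horner_poch !hornerE /newton_coef; ring.
Qed.

Lemma horner_newton (K : numFieldType) (H : {poly K}) (d : nat) (t : K) :
  (size H <= d.+1)%N ->
  H.[t] = \sum_(k < d.+1) newton_coef H k * poch (- t) k.
Proof.
move=> sH; rewrite {1}(newton_expansion sH) horner_sum; apply: eq_bigr => k _.
by rewrite hornerZ horner_poch !hornerE.
Qed.

(** * The first Miller-Paris operator *)

Lemma size_MP1 (K : fieldType) w (e rho : K) H : (size (MP1 w e rho H) <= w.+1)%N.
Proof.
rewrite (leq_trans (size_scale_leq _ _)) // (leq_trans (size_sum _ _ _)) //.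
apply/bigmax_leqP => k _; rewrite (leq_trans (size_scale_leq _ _)) //.
rewrite (leq_trans (size_polyMleq _ _)) //.
rewrite -subn1 leq_subLR (leq_trans (leq_add (size_pochNX _ _) (size_pochDX _ _))) //.
by rewrite addSn addnS subnKC // -ltnS.
Qed.

Lemma horner_MP1 (K : numFieldType) w (e rho : K) H t :
  (MP1 w e rho H).[t] = (poch (rho - e - w%:R) w)^-1 *
    \sum_(k < w.+1) (-1) ^+ k * poch e k * newton_coef H k *
      (poch (- t) k * poch (rho - e - w%:R + t) (w - k)).
Proof.
rewrite hornerZ horner_sum; congr (_ * _); apply: eq_bigr => k _.
by rewrite hornerZ hornerM !horner_poch !hornerE /newton_coef; ring.
Qed.

Lemma MP1_at0 (K : numFieldType) w (e rho : K) H :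
  poch (rho - e - w%:R) w != 0 -> (MP1 w e rho H).[0] = H.[0].
Proof.
move=> nz; rewrite horner_MP1 big_ord_recl big1 => [|k _]; last first.
  by rewrite oppr0 [poch 0 _]pochS !(mul0r, mulr0).
rewrite /newton_coef big_ord1 /= !poch0 subn0 !addr0 !mul1r fact0 invr1 !mul1r.
by rewrite mulrC mulfK.
Qed.

(** At natural numbers the factor (s + n)_(omega-k) of the operator, where
    s = rho - e - omega, absorbs (s)_n:
      (s)_n (s + n)_(omega-k) = (s)_omega (rho - e)_(n-k)   for k <= n,
    and (-n)_k = 0 for k > n, so that the truncated n - k is harmless. *)
Lemma poch_MP1_nat (K : numFieldType) w (e rho : K) H n :
  poch (rho - e - w%:R) w != 0 ->
  poch (rho - e - w%:R) n * (MP1 w e rho H).[n%:R] =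
    \sum_(k < w.+1) (-1) ^+ k * poch e k * newton_coef H k *
      (poch (- n%:R) k * poch (rho - e) (n - k)).
Proof.
move=> nz; rewrite horner_MP1 mulrCA mulr_sumr mulr_sumr; apply: eq_bigr => k _.
have [kn|nk] := leqP k n; last first.
  by rewrite (pochN_nat_small _ nk) !(mul0r, mulr0).
set s := _ - w%:R in nz *.
have -> : rho - e = s + w%:R by rewrite subrK.
have e1 : poch s n * poch (s + n%:R) (w - k) = poch s w * poch (s + w%:R) (n - k).
  by rewrite -!pochD; congr (poch _ _); have := ltn_ord k; lia.
transitivity ((-1) ^+ k * poch e k * newton_coef H k * poch (- n%:R) k *
   ((poch s w)^-1 * (poch s n * poch (s + n%:R) (w - k)))); first by ring.
by rewrite e1 mulKf //; ring.
Qed.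

Lemma pochN_nat_fact_shift (K : numFieldType) (k i : nat) :
  poch (- (k + i)%:R : K) k / ((k + i)`!)%:R = (-1) ^+ k / (i`!)%:R.
Proof.
rewrite pochN_nat -(ffact_fact (leq_addr i k)) addKn natrM.
have h1 := fact_neq0 K i; have h2 : ((k + i) ^_ k)%:R != 0 :> K.
  by rewrite pnatr_eq0 -lt0n ffact_gt0 leq_addr.
by field; apply/andP.
Qed.

(** Newton expansion of (c + t)_m1 / (c)_m1 H(t).  Here s = - (m1 + w), so the
    operator is well defined as soon as m1 > 0. *)
Lemma MP1_newton (K : numFieldType) w m1 (c : K) (H : {poly K}) t :
  (forall n, poch c n != 0) -> (0 < m1)%N -> (size H <= w.+1)%N ->
  poch (c + t) m1 / poch c m1 * H.[t] =
  \sum_(n < (m1 + w).+1) poch (- (m1 + w)%:R) n / (poch c n * (n`!)%:R) *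
    (MP1 w (c + m1%:R) c H).[n%:R] * poch (- t) n.
Proof.
move=> cnz m1_gt0 sH.
have s_eq : c - (c + m1%:R) - w%:R = - (m1 + w)%:R by rewrite natrD; ring.
have nz : poch (c - (c + m1%:R) - w%:R) w != 0.
  rewrite s_eq pochN_nat mulf_neq0 ?signr_eq0 // pnatr_eq0 -lt0n ffact_gt0.
  by rewrite leq_addl.
transitivity (\sum_(n < (m1 + w).+1) \sum_(k < w.+1)
   (-1) ^+ k * poch (c + m1%:R) k * newton_coef H k *
   (poch (- t) n * poch (- m1%:R) (n - k) / poch c n * (poch (- n%:R) k / (n`!)%:R))).
  rewrite exchange_big (horner_newton t sH) mulr_sumr; apply: eq_bigr => k _.
  have kw : (k <= w)%N by rewrite -ltnS.
  rewrite -mulr_sumr (@sum_ord_drop _ (m1 + w) k (fun n =>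
     poch (- t) n * poch (- m1%:R) (n - k) / poch c n *
     (poch (- n%:R) k / (n`!)%:R))); first last.
  - by move=> n nk; rewrite (pochN_nat_small _ nk) mul0r mulr0.
  - by rewrite (leq_trans kw) // leq_addl.
  (* The inner sum stops at i = m1 because of (-m1)_i. *)
  rewrite (@sum_ord_trunc _ m1 _ (fun i => poch (- t) (k + i) *
     poch (- m1%:R) (k + i - k) / poch c (k + i) *
     (poch (- (k + i)%:R) k / ((k + i)`!)%:R))); first last.
  - by move=> n m1n; rewrite addKn (pochN_nat_small _ m1n) mulr0 !mul0r.
  - by rewrite -addnBA // leq_addr.
  transitivity ((-1) ^+ k * poch (c + m1%:R) k * newton_coef H k *
     ((-1) ^+ k * poch (- t) k / (poch c m1 * poch (c + m1%:R) k) *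
       poch (c + k%:R - (- t + k%:R)) m1)); last first.
    congr (_ * _); rewrite -chu_vandermonde mulr_sumr; apply: eq_bigr => i _.
    have im : (i <= m1)%N by rewrite -ltnS.
    rewrite addKn pochN_nat_fact_shift.
    have -> : poch c m1 * poch (c + m1%:R) k =
        poch c (k + i) * poch (c + k%:R + i%:R) (m1 - i).
      by rewrite -pochD -addrA -natrD -pochD -addnA subnKC // addnC.
    transitivity ((-1) ^+ k * poch (- t) (k + i) / poch c (k + i) *
      (poch (- m1%:R) i / (i`!)%:R)); last by ring.
    rewrite pochN_nat_fact [poch (- t) (k + i)]pochD.
    have h1 := cnz (k + i)%N.
    have h2 : poch (c + k%:R + i%:R) (m1 - i) != 0.
      have := cnz (k + i + (m1 - i))%N.
      by rewrite pochD natrD addrA mulf_eq0 negb_or => /andP[].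
    by field; apply/andP.
  have -> : c + k%:R - (- t + k%:R) = c + t by ring.
  have h1 := cnz m1.
  have h2 : poch (c + m1%:R) k != 0.
    by have := cnz (m1 + k)%N; rewrite pochD mulf_eq0 negb_or => /andP[].
  have sg : (-1) ^+ k * (-1) ^+ k = 1 :> K by rewrite -expr2 sqrr_sign.
  transitivity ((-1) ^+ k * (-1) ^+ k * (newton_coef H k * poch (- t) k *
    poch (c + t) m1 / poch c m1)); first by rewrite sg; field.
  by field; apply/andP.
apply: eq_bigr => n _.
rewrite -s_eq; transitivity (poch (- t) n / (poch c n * (n`!)%:R) *
   (poch (c - (c + m1%:R) - w%:R) n * (MP1 w (c + m1%:R) c H).[n%:R])); last by ring.
rewrite poch_MP1_nat // mulr_sumr; apply: eq_bigr => k _.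
have -> : c - (c + m1%:R) = - m1%:R by ring.
have h1 := cnz n; have h2 := fact_neq0 K n.
by field; apply/andP.
Qed.

(** Second half of the generalized Euler transformation, for terminating
    series.  On the Newton basis vector (-t)_k it is the transformation
    [pfaff_sum] with parameters m - k, a + k and c + k. *)
Lemma MP1_pfaff (K : numFieldType) m w (a c x : K) (G : {poly K}) :
  (forall n, poch c n != 0) -> (w <= m)%N -> (size G <= w.+1)%N ->
  poch (c - a - w%:R) w != 0 ->
  \sum_(n < m.+1) poch (- m%:R) n / (poch c n * (n`!)%:R) * G.[n%:R] *
     ((-1) ^+ n * poch a n * x ^+ n * (1 - x) ^+ (m - n)) =
  \sum_(n < m.+1) poch (- m%:R) n * poch (c - a - w%:R) n /
     (poch c n * (n`!)%:R) * (MP1 w a c G).[n%:R] * x ^+ n.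
Proof.
move=> cnz wm sG nz.
transitivity (\sum_(n < m.+1) \sum_(k < w.+1) newton_coef G k *
   (poch (- m%:R) n / poch c n * ((-1) ^+ n * poch a n * x ^+ n * (1 - x) ^+ (m - n)) *
     (poch (- n%:R) k / (n`!)%:R))).
  apply: eq_bigr => n _; rewrite (horner_newton _ sG) mulr_sumr mulr_suml.
  apply: eq_bigr => k _; have h1 := cnz n; have h2 := fact_neq0 K n.
  by field; apply/andP.
transitivity (\sum_(n < m.+1) \sum_(k < w.+1) newton_coef G k *
   (poch (- m%:R) n / poch c n * ((-1) ^+ k * poch a k * poch (c - a) (n - k) * x ^+ n)
     * (poch (- n%:R) k / (n`!)%:R))); last first.
  apply: eq_bigr => n _.
  transitivity (poch (- m%:R) n / (poch c n * (n`!)%:R) * x ^+ n *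
     (poch (c - a - w%:R) n * (MP1 w a c G).[n%:R])); last by ring.
  rewrite poch_MP1_nat // mulr_sumr.
  apply: eq_bigr => k _; have h1 := cnz n; have h2 := fact_neq0 K n.
  by field; apply/andP.
rewrite exchange_big [RHS]exchange_big; apply: eq_bigr => k _ /=.
have km : (k <= m)%N by rewrite (leq_trans _ wm) // -ltnS.
rewrite -!mulr_sumr; congr (_ * _).
rewrite (@sum_ord_drop _ m k (fun n => poch (- m%:R) n / poch c n *
   ((-1) ^+ n * poch a n * x ^+ n * (1 - x) ^+ (m - n)) *
     (poch (- n%:R) k / (n`!)%:R))) //; last first.
  by move=> n nk; rewrite (pochN_nat_small _ nk) mul0r mulr0.
rewrite (@sum_ord_drop _ m k (fun n => poch (- m%:R) n / poch c n *
   ((-1) ^+ k * poch a k * poch (c - a) (n - k) * x ^+ n) *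
     (poch (- n%:R) k / (n`!)%:R))) //; last first.
  by move=> n nk; rewrite (pochN_nat_small _ nk) mul0r mulr0.
(* Clearing denominators by (c)_m brings out the weights of [pfaff_sum]. *)
have weight i : (i <= m - k)%N ->
   poch (- m%:R) (k + i) / poch c (k + i) * (poch (- (k + i)%:R) k / ((k + i)`!)%:R) =
   (-1) ^+ k * poch (- m%:R) k / poch c m *
     ((-1) ^+ i * 'C(m - k, i)%:R * poch (c + k%:R + i%:R) (m - k - i)).
  move=> im; rewrite pochN_nat_fact_shift pochD.
  have -> : - m%:R + k%:R = - (m - k)%:R :> K by rewrite natrB //; ring.
  rewrite -pochN_nat_fact.
  have -> : poch c m = poch c (k + i) * poch (c + k%:R + i%:R) (m - k - i).
    by rewrite -addrA -natrD -pochD -subnDA subnKC // -leq_subRL.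
  have h1 := cnz (k + i)%N; have h2 := fact_neq0 K i.
  have h3 : poch (c + k%:R + i%:R) (m - k - i) != 0.
    have := cnz (k + i + (m - k - i))%N.
    by rewrite pochD natrD addrA mulf_eq0 negb_or => /andP[].
  by field; apply/and3P.
have sg n : (-1) ^+ n * (-1) ^+ n = 1 :> K by rewrite -expr2 sqrr_sign.
pose u := (-1) ^+ k * poch (- m%:R) k / poch c m * (-1) ^+ k * poch a k * x ^+ k.
transitivity (u * \sum_(i < (m - k).+1) 'C(m - k, i)%:R *
   (poch (a + k%:R) i * poch (c + k%:R + i%:R) (m - k - i) * x ^+ i *
     (1 - x) ^+ (m - k - i))).
  rewrite mulr_sumr; apply: eq_bigr => i _.
  rewrite mulrAC weight -1?ltnS // subnDA [poch a _]pochD !exprD /u.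
  transitivity ((-1) ^+ i * (-1) ^+ i * (u * ('C(m - k, i)%:R *
   (poch (a + k%:R) i * poch (c + k%:R + i%:R) (m - k - i) * x ^+ i *
     (1 - x) ^+ (m - k - i))))); last by rewrite sg mul1r /u.
  by rewrite /u; ring.
rewrite pfaff_sum mulr_sumr; apply: eq_bigr => i _.
rewrite [RHS]mulrAC weight -1?ltnS // addKn !exprD /u.
have -> : c + k%:R - (a + k%:R) = c - a by ring.
by ring.
Qed.
(** * The binomial series *)

(** The ratio test. *)
Lemma is_cvg_series_ratio (R : realType) (u : R^nat) (N : nat) (q : R) :
  0 < q < 1 -> (forall n, (N <= n)%N -> `|u n.+1| <= q * `|u n|) ->
  cvgn (series u).
Proof.
move=> /andP[q0 q1] ratio; apply: normed_cvg.
(* Large enough that |u n| <= C q^n also holds for the first terms. *)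
pose C := \sum_(i < N.+1) `|u i| / q ^+ i.
have C0 : 0 <= C by apply: sumr_ge0 => i _; rewrite divr_ge0 // exprn_ge0 // ltW.
apply: (@series_le_cvg _ _ (geometric C q)) => [n|n|n|] //=.
- by rewrite mulr_ge0 // exprn_ge0 // ltW.
- have init i : (i <= N)%N -> `|u i| <= C * q ^+ i.
    move=> iN; rewrite -ler_pdivrMr ?exprn_gt0 // /C.
    have iN1 : (i < N.+1)%N by [].
    rewrite (bigD1 (Ordinal iN1)) //= lerDl sumr_ge0 // => j _.
    by rewrite divr_ge0 // exprn_ge0 // ltW.
  elim: n => [|n IH]; first exact: init.
  have [/init //|Nn] := leqP n.+1 N.
  by rewrite (le_trans (ratio _ Nn)) // exprS mulrCA ler_pM2l.
- by apply: is_cvg_geometric_series; rewrite gtr0_norm.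
Qed.

(** The coefficients (a)_n / n! of the expansion of (1 - x)^(-a). *)
Definition binom_coef (K : fieldType) (a : K) (n : nat) : K := poch a n / (n`!)%:R.

Lemma binom_coefS (K : numFieldType) (a : K) (n : nat) :
  binom_coef a n.+1 = binom_coef a n * ((a + n%:R) / n.+1%:R).
Proof.
rewrite /binom_coef pochSr factS natrM.
have h1 := fact_neq0 K n; have h2 : n.+1%:R != 0 :> K by rewrite pnatr_eq0.
by field; apply/andP.
Qed.

(** The coefficientwise form of (1 - x) (1 - x)^(-a-1) = (1 - x)^(-a). *)
Lemma binom_coef_rec (K : numFieldType) (a : K) (n : nat) :
  binom_coef (a + 1) n.+1 - binom_coef (a + 1) n = binom_coef a n.+1.
Proof.
rewrite binom_coefS /binom_coef pochS factS natrM -addrA -mulrS.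
have h1 := fact_neq0 K n; have h2 : n.+1%:R != 0 :> K by rewrite pnatr_eq0.
rewrite -[n.+1]add1n natrD in h2 *.
by field; apply/andP.
Qed.

Lemma scale_seqE (R : realType) (b : R) (u : R^nat) n : (b *: u) n = b * u n.
Proof. by []. Qed.

Lemma pseries_diffs_binom (R : realType) (a : R) :
  pseries_diffs (binom_coef a) = a *: binom_coef (a + 1).
Proof.
apply/funext => n; rewrite scale_seqE /pseries_diffs /binom_coef pochS factS natrM.
have h1 := fact_neq0 R n; have h2 : n.+1%:R != 0 :> R by rewrite pnatr_eq0.
by field; apply/andP.
Qed.

Lemma is_cvg_binom_series (R : realType) (a x : R) :
  `|x| < 1 -> cvgn (pseries (binom_coef a) x).
Proof.
move=> x1; pose q := (1 + `|x|) / 2.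
have q0 : 0 < q by rewrite divr_gt0 // ltr_pwDl.
have q1 : q < 1 by rewrite /q; lra.
have xq : `|x| < q by rewrite /q; lra.
(* For n >= b, the ratio |a + n| |x| / (n + 1) of consecutive terms is at most
   q. *)
pose b := `|a| / (q - `|x|).
have b0 : 0 <= b by rewrite divr_ge0 // subr_ge0 ltW.
apply: (@is_cvg_series_ratio _ _ (Num.Def.archi_bound b) q) => [|n Nn].
  by rewrite q0.
have bn : b <= n%:R by rewrite (le_trans (ltW (archi_boundP b0))) // ler_nat.
rewrite /= binom_coefS exprS.
have -> : binom_coef a n * ((a + n%:R) / n.+1%:R) * (x * x ^+ n) =
  (a + n%:R) / n.+1%:R * x * (binom_coef a n * x ^+ n) by ring.
rewrite normrM; apply: ler_wpM2r => //.
rewrite normrM normrM normfV [`|n.+1%:R|]gtr0_norm // mulrAC ler_pdivrMr //.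
apply: (@le_trans _ _ ((`|a| + n%:R) * `|x|)).
  apply: ler_wpM2r => //; rewrite (le_trans (ler_normD _ _)) //.
  by rewrite normr_nat.
have an : `|a| <= n%:R * (q - `|x|) by rewrite -ler_pdivrMr // subr_gt0.
have ax : `|a| * `|x| <= `|a| by rewrite ler_piMr // ltW.
rewrite -[n.+1]addn1 natrD mulrDl mulrDr mulr1; nra.
Qed.

(** The sum of the binomial series; meaningful for |x| < 1. *)
Definition binom_sum (R : realType) (a x : R) : R :=
  limn (pseries (binom_coef a) x).

Lemma is_derive_binom_sum (R : realType) (a x : R) :
  `|x| < 1 -> is_derive x (1 : R) (binom_sum a) (a * binom_sum (a + 1) x).
Proof.
move=> x1; pose q := (1 + `|x|) / 2.
have q0 : 0 < q by rewrite divr_gt0 // ltr_pwDl.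
have q1 : `|q| < 1 by rewrite gtr0_norm // /q; lra.
have xq : `|x| < `|q| by rewrite [`|q|]gtr0_norm // /q; lra.
have scaled (b : R) c y : pseries (b *: c) y = b *: pseries c y.
  apply/funext => n; rewrite scale_seqE /pseries !seriesEord /= mulr_sumr.
  by apply: eq_bigr => i _; rewrite scale_seqE mulrA.
have diffs_scaled (b : R) c : pseries_diffs (b *: c) = b *: pseries_diffs c.
  by apply/funext => n; rewrite /pseries_diffs !scale_seqE mulrCA.
have -> : a * binom_sum (a + 1) x = limn (pseries (pseries_diffs (binom_coef a)) x).
  rewrite pseries_diffs_binom scaled limZl_tmp //.
  exact: is_cvg_binom_series.
apply: (@pseries_snd_diffs _ _ q) => //.
- exact: is_cvg_binom_series.
- rewrite pseries_diffs_binom scaled; apply: is_cvgZl_tmp.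
  exact: is_cvg_binom_series.
- rewrite pseries_diffs_binom diffs_scaled pseries_diffs_binom !scaled.
  by do 2! apply: is_cvgZl_tmp; exact: is_cvg_binom_series.
Qed.

Lemma binom_sum_rec (R : realType) (a x : R) :
  `|x| < 1 -> (1 - x) * binom_sum (a + 1) x = binom_sum a x.
Proof.
move=> x1; have c0 := @is_cvg_binom_series _ a _ x1.
have c1 := @is_cvg_binom_series _ (a + 1) _ x1.
rewrite mulrBl mul1r; symmetry; apply/cvg_lim => //.
rewrite -cvg_shiftS.
have -> : [sequence pseries (binom_coef a) x n.+1]_n =
    (fun n => pseries (binom_coef (a + 1)) x n.+1) -
      x *: pseries (binom_coef (a + 1)) x.
  apply/funext => n; rewrite !fctE /= /pseries !seriesEord /=.
  elim: n => [|n IH].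
    rewrite !big_ord1 big_ord0 /GRing.scale /= mulr0 subr0.
    by rewrite /binom_coef !poch0.
  rewrite big_ord_recr IH /= [X in _ = X - _]big_ord_recr /=.
  rewrite [X in _ = _ - _ *: X]big_ord_recr /= -binom_coef_rec.
  by rewrite /GRing.scale /= exprS; ring.
apply: cvgB; last exact: cvgZl_tmp.
by rewrite (cvg_shiftS (pseries (binom_coef (a + 1)) x)).
Qed.

Lemma powR_mulr_pred (R : realType) (a u : R) :
  0 < u -> u `^ a = u * u `^ (a - 1).
Proof.
move=> u0; have u_neq0 : (1 + (a - 1) == 0) ==> (u != 0).
  by rewrite (lt0r_neq0 u0) implybT.
by have := powRD u_neq0; rewrite (powRr1 (ltW u0)) => <-; rewrite addrC subrK.
Qed.

(** By [is_derive_binom_sum] and [binom_sum_rec], the function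
    binom_sum a y (1 - y)^a has derivative 0 on ]-1, 1[, and its value at 0
    is 1. *)
Lemma binom_sumE (R : realType) (a x : R) :
  `|x| < 1 -> binom_sum a x = (1 - x) `^ (- a).
Proof.
move=> x1; pose g y := binom_sum a y * (1 - y) `^ a.
have dg (y : R) : `|y| < 1 -> is_derive y (1 : R) g 0.
  move=> y1; have y_gt0 : 0 < 1 - y.
    by rewrite subr_gt0 (le_lt_trans (ler_norm y)).
  have d1 := @is_derive_binom_sum _ a _ y1.
  have d2 : is_derive y (1 : R) (fun z => (1 - z) `^ a) (- (a * (1 - y) `^ (a - 1))).
    have d3 := is_derive1_powR a y_gt0.
    have d4 : is_derive y (1 : R) (fun z : R => 1 - z) (-1).
      have := is_deriveB (is_derive_cst (1 : R) y 1) (is_derive_id y (1 : R)).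
      by rewrite sub0r.
    have := @is_derive1_comp _ (fun t => t `^ a) (fun z : R => 1 - z) _ _ _ d3 d4.
    by rewrite mulrN1.
  have := is_deriveM d1 d2; rewrite /GRing.scale /=.
  have -> : binom_sum a y * - (a * (1 - y) `^ (a - 1)) +
      (1 - y) `^ a * (a * binom_sum (a + 1) y) = 0; last by [].
  by rewrite -(@binom_sum_rec _ a _ y1) (powR_mulr_pred a y_gt0); ring.
have gcst (y z : R) : `|y| < 1 -> `|z| < 1 -> y <= z -> g y = g z.
  move=> y1 z1 yz.
  have inside t : t \in `[y, z] -> `|t| < 1.
    rewrite in_itv /= => /andP[yt tz]; move: y1 z1; rewrite !ltr_norml.
    move=> /andP[y1 _] /andP[_ z1].
    by rewrite (lt_le_trans y1) // (le_lt_trans tz).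
  have [||c _] := @MVT_segment _ g (fun=> 0) _ _ yz.
  - move=> t tyz; apply/dg/inside.
    by move: tyz; rewrite !in_itv /= => /andP[/ltW -> /ltW ->].
  - apply: derivable_within_continuous => t tyz.
    by have [] := dg t (inside t tyz).
  - by rewrite mul0r => /eqP; rewrite subr_eq0 => /eqP.
have g0 : g 0 = 1.
  rewrite /g subr0 powR1 mulr1; apply/cvg_lim => //.
  apply: cvg_near_cst; exists 1%N => // n /= n0.
  rewrite /pseries seriesEord /= -(prednK n0) big_ord_recl /= big1 ?addr0.
    by rewrite /binom_coef poch0 fact0 expr0 mulr1 divr1.
  by move=> i _; rewrite exprS mul0r mulr0.
have gx : g x = 1.
  have z1 : `|0 : R| < 1 by rewrite normr0.
  by rewrite -g0; have [/gcst ->|/ltW /gcst ->] := leP x 0.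
have x_gt0 : 0 < 1 - x by rewrite subr_gt0 (le_lt_trans (ler_norm x)).
by rewrite powRN -[LHS](mulfK (lt0r_neq0 (powR_gt0 a x_gt0))) -/(g x) gx mul1r.
Qed.

Lemma cvg_binom_series (R : realType) (a x : R) :
  `|x| < 1 -> pseries (binom_coef a) x @ \oo --> (1 - x) `^ (- a).
Proof. by move=> x1; rewrite -binom_sumE //; exact: is_cvg_binom_series. Qed.

(** The first k terms vanish and the others form the binomial series of
    exponent a + k. *)
Lemma cvg_binom_series_ffact (R : realType) (a x : R) (k : nat) :
  `|x| < 1 ->
  series (fun n => poch (- n%:R) k * binom_coef a n * x ^+ n) @ \oo -->
    (-1) ^+ k * poch a k * x ^+ k * (1 - x) `^ (- (a + k%:R)).
Proof.
move=> x1; rewrite -(cvg_shiftn k).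
have -> : [sequence series (fun n => poch (- n%:R) k * binom_coef a n * x ^+ n)
              (n + k)%N]_n =
    ((-1) ^+ k * poch a k * x ^+ k) *: pseries (binom_coef (a + k%:R)) x.
  apply/funext => n; rewrite fctE /= /pseries !seriesEord /= addnC big_split_ord /=.
  rewrite big1 ?add0r => [|i _]; last by rewrite pochN_nat_small // !mul0r.
  rewrite scaler_sumr; apply: eq_bigr => i _.
  rewrite /binom_coef /GRing.scale /= pochD exprD.
  transitivity (poch (- (k + i)%:R : R) k / ((k + i)`!)%:R *
     (poch a k * poch (a + k%:R) i * (x ^+ k * x ^+ i))); first by ring.
  by rewrite pochN_nat_fact_shift; ring.
by apply: cvgZl_tmp; exact: cvg_binom_series.
Qed.

(** * The numerator polynomial *)

Lemma horner_Xn_subXn (A : comNzRingType) (k l : nat) (x : A) :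
  ('X^k * (1 - 'X) ^+ l).[x] = x ^+ k * (1 - x) ^+ l.
Proof. by rewrite hornerM horner_exp !hornerE. Qed.

Lemma is_what_newton (R : realType) (m : nat) (a : R) (F : {poly R}) (g : nat -> R) :
  (forall t, F.[t] = \sum_(k < m.+1) g k * poch (- t) k) ->
  is_what m a F (\sum_(k < m.+1) (g k * ((-1) ^+ k * poch a k)) *:
    ('X^k * (1 - 'X) ^+ (m - k))).
Proof.
move=> FE; split.
  rewrite (leq_trans (size_sum _ _ _)) //; apply/bigmax_leqP => k _.
  have km : (k <= m)%N by rewrite -ltnS.
  rewrite (leq_trans (size_scale_leq _ _)) //.
  rewrite (leq_trans (size_polyMleq _ _)) // size_polyXn addSn /=.
  rewrite (leq_trans (leq_add (leqnn k) (size_poly_exp_leq _ _))) //.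
  have s1 : (size (1 - 'X : {poly R})%R <= 2)%N.
    by rewrite (leq_trans (size_polyD _ _)) // size_polyN size_polyX size_poly1.
  rewrite addnS ltnS -[leqRHS](subnKC km) leq_add2l.
  case: (size _) s1 => [|[|[|]]] //= _; rewrite ?mul0n ?mul1n //.
move=> x x1; have x_gt0 : 0 < 1 - x by rewrite subr_gt0 (le_lt_trans (ler_norm x)).
have -> : series (fun n : nat => F.[n%:R] * (poch a n / (n`!)%:R) * x ^+ n) =
    (fun N => \sum_(k < m.+1) (g k *:
       series (fun n => poch (- n%:R) k * binom_coef a n * x ^+ n)) N).
  apply/funext => N; rewrite seriesEord /=.
  under eq_bigr do rewrite FE mulr_suml mulr_suml.
  rewrite exchange_big /=; apply: eq_bigr => k _.
  rewrite fctE /= seriesEord /= scaler_sumr; apply: eq_bigr => n _.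
  by rewrite /GRing.scale /= !mulrA.
rewrite horner_sum mulr_suml; apply: cvg_big => [|k _].
  exact: add_continuous.
rewrite hornerZ horner_Xn_subXn.
have km : (k <= m)%N by rewrite -ltnS.
have -> : g k * ((-1) ^+ k * poch a k) * (x ^+ k * (1 - x) ^+ (m - k)) /
    (1 - x) `^ (m%:R + a) =
  g k *: ((-1) ^+ k * poch a k * x ^+ k * (1 - x) `^ (- (a + k%:R))).
  have -> : (1 - x) `^ (- (a + k%:R)) = (1 - x) ^+ (m - k) / (1 - x) `^ (m%:R + a).
    rewrite -powR_mulrn ?ltW // -powRB; last by rewrite (lt0r_neq0 x_gt0) implybT.
    by congr (_ `^ _); rewrite natrB //; ring.
  by rewrite /GRing.scale /=; ring.
by apply: cvgZl_tmp; exact: cvg_binom_series_ffact.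
Qed.

Lemma is_what_unique (R : realType) (m : nat) (a : R) (F w1 w2 : {poly R}) :
  is_what m a F w1 -> is_what m a F w2 -> w1 = w2.
Proof.
move=> [_ W1] [_ W2]; apply/eqP; rewrite -subr_eq0; apply/negPn/negP => nz.
(* The points 1/2, 1/3, ... of the unit disc are more roots than the degree of
   w1 - w2 allows. *)
pose rs : seq R := [seq i.+2%:R^-1 | i <- iota 0 (size (w1 - w2))].
have rs_root : all (root (w1 - w2)) rs.
  rewrite all_map; apply/allP => i _ /=.
  have x1 : `|i.+2%:R^-1 : R| < 1.
    by rewrite gtr0_norm ?invr_gt0 // invf_lt1 // ltr1n.
  have x_gt0 : 0 < 1 - i.+2%:R^-1 :> R.
    by rewrite subr_gt0 (le_lt_trans (ler_norm _)).
  have e : w1.[i.+2%:R^-1] = w2.[i.+2%:R^-1].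
    apply: (mulIf (invr_neq0 (lt0r_neq0 (powR_gt0 (m%:R + a) x_gt0)))).
    exact: (cvg_unique (@norm_hausdorff _ R^o) (W1 _ x1) (W2 _ x1)).
  by rewrite /root !hornerE e subrr.
have rs_uniq : uniq rs.
  rewrite map_inj_uniq ?iota_uniq // => i j /invr_inj /eqP.
  by rewrite eqr_nat => /eqP [].
by have := max_poly_roots nz rs_root rs_uniq; rewrite size_map size_iota ltnn.
Qed.

Lemma what_eq (R : realType) (m : nat) (a : R) (F w : {poly R}) :
  is_what m a F w -> what m a F = w.
Proof.
move=> W; apply: xget_unique => // w' W'; exact: (is_what_unique W' W).
Qed.
(** * Hypergeometric form *)

Lemma poch_neq0 (R : fieldType) (b : R) (n : nat) :
  (forall k : nat, b != - k%:R) -> poch b n != 0.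
Proof. by move=> nz; rewrite /poch; apply/prodf_neq0 => i _; rewrite addr_eq0. Qed.

Lemma lim_series_finite (K : numFieldType) (u : nat -> K^o) (m : nat) :
  (forall n, (m < n)%N -> u n = 0) ->
  limn (series u) = \sum_(n < m.+1) u n.
Proof.
move=> u0; apply: lim_near_cst; first exact: norm_hausdorff.
exists m.+1 => // n /= mn; rewrite seriesEord /=.
rewrite -(prednK (leq_trans _ mn)) //; apply: sum_ord_trunc => //.
by rewrite -ltnS (prednK (leq_trans _ mn)).
Qed.

Lemma hypergeom_terminating (K : numFieldType) (m : nat) (aa bb : seq K) (x : K) :
  hypergeom (- m%:R :: aa) bb x =
  \sum_(n < m.+1) poch (- m%:R) n * \prod_(b <- aa) poch b n /
    (\prod_(b <- bb) poch b n * (n`!)%:R) * x ^+ n.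
Proof.
rewrite /hypergeom (lim_series_finite (m := m)).
  by apply: eq_bigr => n _; rewrite big_cons.
by move=> n mn; rewrite big_cons (pochN_nat_small _ mn) !mul0r.
Qed.

(** Each root z of P(-t) contributes (z + 1)_n / (z)_n = (z + n) / z, and the
    product of these is P(n) / P(0). *)
Lemma prod_poch_roots (K : fieldType) (P : {poly K}) (s : seq K) (n : nat) :
  P.[0] = 1 -> is_root_list (P \Po - 'X) s ->
  \prod_(z <- s) poch (z + 1) n = \prod_(z <- s) poch z n * P.[n%:R].
Proof.
move=> P0 Ps; have PE t : P.[t] = lead_coef (P \Po - 'X) * \prod_(z <- s) (- t - z).
  have -> : P.[t] = (P \Po - 'X).[- t] by rewrite horner_comp !hornerE opprK.
  rewrite {1}Ps hornerZ horner_prod; congr (_ * _).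
  by apply: eq_bigr => z _; rewrite !hornerE.
transitivity (\prod_(z <- s) poch (z + 1) n * P.[0]); first by rewrite P0 mulr1.
rewrite !PE !(mulrCA _ (lead_coef _)); congr (_ * _).
rewrite -!big_split; apply: eq_bigr => z _ /=.
by rewrite oppr0 sub0r -opprD !mulrN mulrC -pochS pochSr addrC [_ + z]addrC.
Qed.

(** * Products of normalized Pochhammer polynomials *)

Lemma size_poch_ratio (R : fieldType) (I : finType) (P : pred I) (f : I -> R)
    (m : I -> nat) : (size (poch_ratio P f m) <= (\sum_(i | P i) m i).+1)%N.
Proof.
rewrite (leq_trans (size_scale_leq _ _)) //.
elim/big_rec2: _ => [|i s p _ IH]; first by rewrite size_poly1.
rewrite (leq_trans (size_polyMleq _ _)) // -subn1 leq_subLR.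
by rewrite (leq_trans (leq_add (size_pochDX _ _) IH)) // addSn addnS.
Qed.

Lemma poch_ratio_at0 (R : fieldType) (I : finType) (P : pred I) (f : I -> R)
    (m : I -> nat) :
  (forall i, poch (f i) (m i) != 0) -> (poch_ratio P f m).[0] = 1.
Proof.
move=> nz; rewrite hornerZ horner_prod.
under [X in _ * X]eq_bigr do rewrite horner_poch !hornerE.
by rewrite mulVf //; apply/prodf_neq0.
Qed.

(** Splitting off the factor of index i0. *)
Lemma poch_ratioD1 (R : fieldType) (I : finType) (i0 : I) (f : I -> R)
    (m : I -> nat) (t : R) :
  (poch_ratio predT f m).[t] =
  poch (f i0 + t) (m i0) / poch (f i0) (m i0) * (poch_ratio (predC1 i0) f m).[t].
Proof.
rewrite /poch_ratio (bigD1 i0) //= [X in _ *: X](bigD1 i0) //= !hornerZ hornerM.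
by rewrite horner_poch hornerD hornerC hornerX invfM; ring.
Qed.

Theorem proposition1 (R : realType) (r : nat) (m : 'I_r.+1 -> nat)
    (f : 'I_r.+1 -> R) (a : R)
    (m_gt0 : forall i, (0 < m i)%N)
    (f_npos : forall i (k : nat), f i != - k%:R)
    (m1_max : forall i, (m i <= m ord0)%N) :
  let mm := (\sum_i m i)%N in
  let m1 := m ord0 in
  let f1 := f ord0 in
  let omega := (mm - m1)%N in
  let F := poch_ratio predT f m in
  let H := poch_ratio (predC1 ord0) f m in
  let Q := MP2 omega a (f1 + m1%:R) f1 H in
  poch (f1 - a - omega%:R) omega != 0 ->
  0 < a \/ (a < 0 /\ poch (1 + a + m1%:R) omega != 0) ->
  [/\ (size Q <= omega.+1)%N,
      what mm a F =
        \sum_(n < mm.+1)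
          (poch (- mm%:R) n * poch (f1 - a - omega%:R) n /
             (poch f1 n * (n`!)%:R) * Q.[n%:R]) *: 'X^n
    & forall eta : omega.-tuple R[i],
        is_root_list (map_poly (real_complex R) (Q \Po - 'X)) eta ->
        (forall i, poch (tnth eta i) mm != 0) ->
        forall x : R[i],
          (map_poly (real_complex R) (what mm a F)).[x] =
          hypergeom
            [:: real_complex R (- mm%:R), real_complex R (f1 - a - omega%:R)
              & [seq z + 1 | z <- eta]]
            (real_complex R f1 :: eta) x].
Proof.
move=> mm m1 f1 omega F H Q s_neq0 _.
have f_neq0 i n : poch (f i) n != 0 by exact: poch_neq0.
have f1_neq0 n : poch f1 n != 0 by exact: f_neq0.
have mmE : mm = (m1 + omega)%N by rewrite /omega subnKC // /mm (bigD1 ord0) ?leq_addr.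
have sizeH : (size H <= omega.+1)%N.
  rewrite (leq_trans (size_poch_ratio _ _ _)) // ltnS /omega /mm.
  by rewrite [leqRHS](_ : _ = \sum_(i | i != ord0) m i)%N // (bigD1 ord0) //= addKn.
pose Q1 := MP1 omega (f1 + m1%:R) f1 H.
have sizeQ1 : (size Q1 <= omega.+1)%N by exact: size_MP1.
(* The Newton coefficients of F. *)
pose g n := poch (- mm%:R) n / (poch f1 n * (n`!)%:R) * Q1.[n%:R].
have FE t : F.[t] = \sum_(n < mm.+1) g n * poch (- t) n.
  by rewrite (poch_ratioD1 ord0) (MP1_newton t f1_neq0 (m_gt0 ord0) sizeH) /g mmE.
have whatE : what mm a F = \sum_(n < mm.+1)
    (poch (- mm%:R) n * poch (f1 - a - omega%:R) n / (poch f1 n * (n`!)%:R) *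
       Q.[n%:R]) *: 'X^n.
  have W := is_what_newton a FE; rewrite (what_eq W).
  apply: (poly_nat_inj W.1) => [|j _].
    rewrite (leq_trans (size_sum _ _ _)) //; apply/bigmax_leqP => n _.
    by rewrite (leq_trans (size_scale_leq _ _)) // size_polyXn.
  have omega_mm : (omega <= mm)%N by rewrite mmE leq_addl.
  rewrite !horner_sum; under [RHS]eq_bigr do rewrite hornerZ hornerXn.
  rewrite -(MP1_pfaff j%:R f1_neq0 omega_mm sizeQ1 s_neq0).
  apply: eq_bigr => n _; rewrite hornerZ horner_Xn_subXn /g.
  by rewrite -/Q1; ring.
split=> //; first exact: size_MP1.
move=> eta etaP eta_neq0 x.
have Q0 : Q.[0] = 1.
  rewrite MP1_at0 // MP1_at0.
    by apply: poch_ratio_at0 => i.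
  (* The inner operator has s = - mm, and (- mm)_omega != 0 as omega <= mm. *)
  have -> : f1 - (f1 + m1%:R) - omega%:R = - mm%:R by rewrite mmE natrD; ring.
  rewrite pochN_nat mulf_neq0 ?signr_eq0 // pnatr_eq0 -lt0n ffact_gt0.
  by rewrite mmE leq_addl.
have QE n : \prod_(z <- eta) poch (z + 1) n =
    \prod_(z <- eta) poch z n * real_complex R Q.[n%:R].
  rewrite (@prod_poch_roots _ (map_poly (real_complex R) Q)).
  - by rewrite -(rmorph_nat (real_complex R)) horner_map.
  - by rewrite -(rmorph0 (real_complex R)) horner_map Q0 rmorph1.
  - by move: etaP; rewrite map_comp_poly rmorphN /= map_polyX.
have -> : real_complex R (- mm%:R) = - mm%:R by rewrite rmorphN rmorph_nat.
rewrite hypergeom_terminating whatE rmorph_sum horner_sum /=.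
apply: eq_bigr => n _; rewrite map_polyZ map_polyXn hornerZ hornerXn; congr (_ * _).
rewrite !big_cons big_map QE.
(* As n <= mm, the hypothesis on eta makes every (eta_i)_n nonzero. *)
have nz : \prod_(z <- eta) poch z n != 0.
  rewrite prodf_seq_neq0; apply/allP => z /tnthP[i ->] /=.
  by apply: poch_neq0_trunc (eta_neq0 i); rewrite -ltnS.
have h1 : real_complex R (poch f1 n) != 0 by rewrite fmorph_eq0.
have h2 := fact_neq0 R[i] n.
rewrite !rmorphM fmorphV rmorphM !rmorph_poch rmorphN !rmorph_nat -!rmorph_poch.
by field; apply/and3P.
Qed.
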